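(* Let $(X,d_X)$ be a metric space and let $\mathcal{F}:X\to\mathbb{R}\cup\{+\infty\}$ be a lower semi-continuous function that is bounded below and such that there is $\tau_0>0$ for which, for every $0<\tau<\tau_0$ and every $v\in X$, the functional $u\mapsto \mathcal{F}(u)+\frac{d_X^2(u,v)}{2\tau}$ attains its minimum on $X$. Let $u_0\in X$ satisfy $\mathcal{F}(u_0)<\infty$. Then there is a constant $C$, depending only on $\mathcal{F}$ and $u_0$, such that the following holds for every $0<\tau<\tau_0$. Let $\{u_k\}_{k\ge 0}$ be a sequence in $X$ starting at $u_0$ such that for each $k\ge 0$, $$u_{k+1}\in \operatorname*{arg\,min}_{u\in X}\Big\{\mathcal{F}(u)+\frac{d_X^2(u,u_k)}{2\tau}\Big\},$$ and let $\{u_{\theta,k}\}_{k\ge 0}$ be a sequence in $X$ with $u_{\theta,0}=u_0$ such that for each $k\ge 0$, $$\mathcal{F}(u_{\theta,k+1})+\frac{d_X^2(u_{\theta,k+1},u_{\theta,k})}{2\tau}\le \mathcal{F}(u_{\theta,k})+\frac{d_X^2(u_{\theta,k},u_{\theta,k})}{2\tau}.$$ Then for every $k\ge 0$, $$d_X(u_{\theta,k+1},u_{k+1})\le d_X(u_{\theta,k},u_k)+C\tau^{1/2}.$$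
   Context: The sequence $\{u_k\}$ is the minimizing movement (JKO) scheme with time step $\tau>0$ for the functional $\mathcal{F}$ started at $u_0$. The sequence $\{u_{\theta,k}\}$ stands for the approximations of it obtained by iteratively (and possibly inexactly) solving the same minimization problem with elements of $X$ parametrized by neural networks; the only property of these approximations that is assumed is the stated inequality. *)

(* Defs.v *)
From HB Require Import structures.
From mathcomp Require Import all_boot all_order all_algebra.
From mathcomp Require Import all_classical all_reals all_analysis.

Set Implicit Arguments.
Unset Strict Implicit.
Unset Printing Implicit Defensive.

Import Order.TTheory GRing.Theory Num.Theory.
Import numFieldNormedType.Exports.

Local Open Scope classical_set_scope.
Local Open Scope ring_scope.

Definition argmin (R : realType) (T : Type) (f : T -> \bar R) : set T :=
  [set u | forall w, (f u <= f w)%E].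

Definition jko_functional (R : realType) (X : metricType R) (F : X -> \bar R)
    (tau : R) (v u : X) : \bar R :=
  (F u + (mdist u v ^+ 2 / (2 * tau))%:E)%E.

Definition minimizing_movement (R : realType) (X : metricType R)
    (F : X -> \bar R) (tau : R) (u0 : X) (u : nat -> X) : Prop :=
  u 0%N = u0 /\ forall k, argmin (jko_functional F tau (u k)) (u k.+1).

(* Main.v *)
Require Import Defs.
From HB Require Import structures.
From mathcomp Require Import all_boot all_order all_algebra.
From mathcomp Require Import all_classical all_reals all_analysis.
From mathcomp Require Import lra.
Import Order.TTheory GRing.Theory Num.Theory.
Import numFieldNormedType.Exports.
Local Open Scope classical_set_scope.
Local Open Scope ring_scope.

(* Along a descent step the energy does not increase, so it stays in
   [m, F u0]; the squared length of each step is at most 2 tau times the energy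
   drop.  Minimizing steps are descent steps, so every step of either sequence
   has length at most sqrt (2 (F u0 - m) tau), and the triangle inequality
   through the two predecessors concludes with twice this bound. *)

(** The right side is kept as [jko_functional F tau v v]: the hypothesis on [utheta] is then this
    property verbatim, and minimality gives it by testing with the competitor [v]. *)
Definition descent_step {R : realType} {X : metricType R} (F : X -> \bar R)
    (tau : R) (v w : X) : Prop :=
  (jko_functional F tau v w <= jko_functional F tau v v)%E.

Lemma jko_functional_diag {R : realType} {X : metricType R} (F : X -> \bar R)
    (tau : R) (v : X) : jko_functional F tau v v = F v.
Proof. by rewrite /jko_functional mdistxx expr0n mul0r adde0. Qed.

Lemma descent_step_le {R : realType} {X : metricType R} {F : X -> \bar R}
    {tau : R} {v w : X} :
  0 < tau -> descent_step F tau v w -> (F w <= F v)%E.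
Proof.
move=> tau_gt0; rewrite /descent_step jko_functional_diag; apply: le_trans.
by rewrite leeDl// lee_fin divr_ge0 ?sqr_ge0// mulr_ge0 ?ltW.
Qed.

Lemma descent_step_mdist {R : realType} {X : metricType R} {F : X -> \bar R}
    {tau m M : R} {v w : X} :
  0 < tau -> (m%:E <= F w)%E -> (F v <= M%:E)%E ->
  descent_step F tau v w ->
  mdist w v <= Num.sqrt (2 * (M - m)) * Num.sqrt tau.
Proof.
move=> tau_gt0 mFw FvM; rewrite /descent_step jko_functional_diag => dvw.
(* Replacing [F w] by its real lower bound [m] turns the extended inequality into one between
   reals. *)
have : ((m + mdist w v ^+ 2 / (2 * tau))%:E <= M%:E)%E.
  by apply: le_trans (le_trans dvw FvM); rewrite EFinD leeD2r.
rewrite lee_fin -lerBrDl ler_pdivrMr ?mulr_gt0// => d2.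
have d2' : mdist w v ^+ 2 <= 2 * (M - m) * tau.
  by lra.
(* Splitting the square root needs this sign; it follows from [d2'], whose left side is a square. *)
have Mm : 0 <= 2 * (M - m).
  by rewrite -(pmulr_lge0 _ tau_gt0) (le_trans (sqr_ge0 _) d2').
rewrite -sqrtrM// -[leLHS]ger0_norm ?mdist_ge0// -sqrtr_sqr.
exact: ler_wsqrtr.
Qed.

Lemma descent_mdist {R : realType} {X : metricType R} {F : X -> \bar R}
    {tau m M : R} {w : nat -> X} :
  0 < tau -> (forall x, (m%:E <= F x)%E) -> (F (w 0%N) <= M%:E)%E ->
  (forall k, descent_step F tau (w k) (w k.+1)) ->
  forall k, mdist (w k.+1) (w k) <= Num.sqrt (2 * (M - m)) * Num.sqrt tau.
Proof.
move=> tau_gt0 mF Fw0 dw k; apply: descent_step_mdist (dw k) => //.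
(* What remains is [F (w k) <= M%:E], propagated from the start by energy decrease. *)
elim: k => // k; exact: le_trans (descent_step_le tau_gt0 (dw k)).
Qed.

Theorem theorem3p6 (R : realType) (X : metricType R) (F : X -> \bar R)
    (F_neq_ninfty : forall x, F x != -oo%E)
    (F_lsc : lower_semicontinuous F)
    (F_bounded_below : exists m : R, forall x, (m%:E <= F x)%E)
    (u0 : X) (Fu0_fin : (F u0 < +oo)%E) :
  exists C : R,
    forall tau0 : R, 0 < tau0 ->
    (forall tau : R, 0 < tau < tau0 ->
       forall v : X, argmin (jko_functional F tau v) !=set0) ->
    forall tau : R, 0 < tau < tau0 ->
    forall u : nat -> X, minimizing_movement F tau u0 u ->
    forall utheta : nat -> X, utheta 0%N = u0 ->
    (forall k : nat,
       (jko_functional F tau (utheta k) (utheta k.+1)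
        <= jko_functional F tau (utheta k) (utheta k))%E) ->
    forall k : nat,
      mdist (utheta k.+1) (u k.+1)
        <= mdist (utheta k) (u k) + C * Num.sqrt tau.
Proof.
have [m mF] := F_bounded_below.
have Fu0 : (F u0 <= (fine (F u0))%:E)%E by rewrite fineK// fin_numE F_neq_ninfty lt_eqF.
(* Here [M] is [fine (F u0)], and the factor 2 counts one step of each sequence. *)
exists (2 * Num.sqrt (2 * (fine (F u0) - m))).
move=> tau0 _ _ tau /andP[tau_gt0 _] u [u0E umin] w w0E dw k.
have du : mdist (u k.+1) (u k) <= Num.sqrt (2 * (fine (F u0) - m)) * Num.sqrt tau.
  by apply: (descent_mdist tau_gt0 mF) => [|j]; [rewrite u0E | exact: umin].
have {}dw : mdist (w k.+1) (w k) <= Num.sqrt (2 * (fine (F u0) - m)) * Num.sqrt tau.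
  by apply: (descent_mdist tau_gt0 mF) => //; rewrite w0E.
(* The path runs from [w k.+1] through [w k] and [u k] to [u k.+1]; its middle leg is the distance
   at stage [k]. *)
have := metric_triangle (w k.+1) (w k) (u k.+1).
have := metric_triangle (w k) (u k) (u k.+1).
rewrite (metric_sym (u k)); lra.
Qed.
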